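(* Let $\varphi:[a,b]\to[a,b]$ where $[a,b]\subset\mathbb{R}$, let $I$ be a convex subset of $\mathbb{R}$, and let $f:I\to\mathbb{R}^{+}$ be a $\varphi$-quasi-convex function. For $x,y\in[a,b]$, $x<y$ and $\lambda\in[0,1]$, one has the inequality $$\frac{1}{\varphi(y)-\varphi(x)}\int_{\varphi(x)}^{\varphi(y)}f(u)\,du\le\max\{f(\varphi(x)),f(\varphi(y))\}.$$
   Context: A function $f:I\to\mathbb{R}^{+}$ is $\varphi$-quasi-convex if $f(t\varphi(x)+(1-t)\varphi(y))\le\max\{f(\varphi(x)),f(\varphi(y))\}$ for all $x,y\in I$ and $t\in[0,1]$.
   Formalization: The points x, y are taken in both [a,b] and I, and φ is assumed to map [a,b]∩I into I (both automatic when I=[a,b]); for x, y in [a,b] outside I the inequality can fail, since φ-quasi-convexity only concerns points of I. *)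

(* Defs.v *)
From HB Require Import structures.
From mathcomp Require Import all_boot all_order all_algebra.
From mathcomp Require Import all_classical all_reals all_analysis.

Set Implicit Arguments.
Unset Strict Implicit.
Unset Printing Implicit Defensive.

Import Order.TTheory GRing.Theory Num.Theory.
Import numFieldNormedType.Exports.

Local Open Scope classical_set_scope.
Local Open Scope ring_scope.

(* phi-quasi-convexity on I. Partial functions are represented by total ones:
   D is the domain of phi, so that phi is only evaluated at points of I where
   it is defined; values of phi outside D play no role. *)
Definition phi_quasi_convex (R : realType) (D I : set R) (phi f : R -> R) :=
  forall x y t : R, (D `&` I) x -> (D `&` I) y -> 0 <= t <= 1 ->
    f (t * phi x + (1 - t) * phi y) <= Num.max (f (phi x)) (f (phi y)).

(* Oriented Lebesgue integral of f from c to d, for c and d in any order.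
   For a nonnegative f, Rintegral is (fine of) the supremum of the integrals of
   the nonnegative simple functions below f, hence also makes sense when f is
   not assumed measurable. *)
Definition oriented_integral (R : realType) (c d : R) (f : R -> R) : R :=
  if c <= d then (\int[lebesgue_measure]_(u in `[c, d]) f u)%R
  else - (\int[lebesgue_measure]_(u in `[d, c]) f u)%R.

(* Main.v *)
(* By quasi-convexity, [f] is bounded by [M = max (f (phi x)) (f (phi y))] on the
   segment joining [phi x] and [phi y], so its mean value there is at most [M]. *)

Require Import Defs.
From HB Require Import structures.
From mathcomp Require Import all_boot all_order all_algebra.
From mathcomp Require Import all_classical all_reals all_analysis.
From mathcomp Require Import ring.

Set Implicit Arguments.
Unset Strict Implicit.
Unset Printing Implicit Defensive.

Import Order.TTheory GRing.Theory Num.Theory.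
Import numFieldNormedType.Exports.

Local Open Scope classical_set_scope.
Local Open Scope ring_scope.

(** Every point between [phi x] and [phi y] is a convex combination of the two, so convexity of [I]
    makes [f] nonnegative there and quasi-convexity bounds it by the maximum [M]. Comparison with
    the constant [M] bounds the mean ([Rintegral_mean_le]), and [oriented_mean_le] covers every
    order of the endpoints. *)

(* Unlike [ge0_le_integral], no measurability: the integral of a nonnegative
   function is a supremum over the simple functions below it. *)
Lemma ge0_le_integral_sup d (T : measurableType d) (R : realType)
    (mu : {measure set T -> \bar R}) (D : set T) (g h : T -> \bar R) :
  (forall x, D x -> 0 <= g x)%E -> (forall x, D x -> g x <= h x)%E ->
  (\int[mu]_(x in D) g x <= \int[mu]_(x in D) h x)%E.
Proof.
move=> g0 gh.
have h0 x : D x -> (0 <= h x)%E by move=> Dx; exact: le_trans (g0 x Dx) (gh x Dx).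
rewrite !ge0_integralE//=; apply: le_ereal_sup => _ [s /= sg <-]; exists s => // x.
by apply: le_trans (sg x) _; exact: lee_restrict.
Qed.

Lemma Rintegral_mean_le (R : realType) (c d M : R) (f : R -> R) : c < d ->
  (forall u, c <= u <= d -> 0 <= f u <= M) ->
  (d - c)^-1 * (\int[lebesgue_measure]_(u in `[c, d]) f u)%R <= M.
Proof.
move=> cd fM; rewrite mulrC ler_pdivrMr ?subr_gt0// /Rintegral.
have f0 u : `[c, d]%classic u -> (0 <= (f u)%:E)%E.
  by rewrite /= in_itv/= => /fM /andP[f0 _]; rewrite lee_fin.
have int0 : (0 <= \int[lebesgue_measure]_(u in `[c, d]) (f u)%:E)%E.
  exact: integral_ge0.
have intM : (\int[lebesgue_measure]_(u in `[c, d]) (f u)%:E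
             <= (M * (d - c))%:E)%E.
  have -> : ((M * (d - c))%:E
             = \int[lebesgue_measure]_(u in `[c, d]) (cst M%:E) u)%E.
    rewrite integral_cst//= lebesgue_measure_itv/= lte_fin cd.
    by rewrite -EFinD -EFinM.
  apply: ge0_le_integral_sup => // u.
  by rewrite /= in_itv/= => /fM /andP[_ fuM]; rewrite lee_fin.
(* The upper bound makes the integral finite, so [fine] keeps its value. *)
rewrite -lee_fin fineK// ge0_fin_numE//.
exact: le_lt_trans intM (ltry _).
Qed.

Lemma itv_convex_comb (R : realFieldType) (c d u : R) : c < d -> c <= u <= d ->
  exists2 t, 0 <= t <= 1 & u = t * c + (1 - t) * d.
Proof.
move=> cd /andP[cu ud]; have dc0 : 0 < d - c by rewrite subr_gt0.
exists ((d - u) / (d - c)); last by field; rewrite gt_eqF.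
rewrite divr_ge0 ?subr_ge0 ?(ltW cd)//=.
by rewrite ler_pdivrMr// mul1r lerD2l lerN2.
Qed.

(** Bounding [f] along the parametrized segment makes the hypothesis symmetric in [c] and [d]. *)
Lemma oriented_mean_le (R : realType) (c d M : R) (f : R -> R) :
  (forall t, 0 <= t <= 1 -> 0 <= f (t * c + (1 - t) * d) <= M) ->
  (d - c)^-1 * oriented_integral c d f <= M.
Proof.
move=> fM; rewrite /oriented_integral; have [cd|dc|<-] := ltgtP c d.
- apply: Rintegral_mean_le => // u /(itv_convex_comb cd)[t t01 ->]; exact: fM.
(* The signs of the reversed integral and of [d - c] cancel; exchanging the endpoints turns [t] into
   [1 - t]. *)
- rewrite mulrN -mulNr -invrN opprB.
  apply: Rintegral_mean_le => // u /(itv_convex_comb dc)[t t01 ->].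
  have -> : t * d + (1 - t) * c = (1 - t) * c + (1 - (1 - t)) * d by ring.
  by apply: fM; case/andP: t01 => t0 t1; rewrite subr_ge0 t1 gerBl.
(* Since [0^-1 = 0], the left side vanishes; [t = 1] gives [0 <= f c <= M]. *)
- rewrite subrr invr0 mul0r.
  by have /andP[f0 ?] := fM 1 ltac:(by rewrite ler01 lexx); exact: le_trans f0 _.
Qed.

Theorem theorem10 (R : realType) (a b : R) (phi : R -> R)
    (phi_ab : set_fun `[a, b] `[a, b] phi)
    (I : set R) (I_convex : @convex_set R R^o I)
    (phi_I : set_fun (`[a, b] `&` I) I phi)
    (f : R -> R) (f_ge0 : forall u, I u -> 0 <= f u)
    (f_qc : phi_quasi_convex `[a, b] I phi f)
    (x y lambda : R)
    (x_ab : x \in `[a, b]) (y_ab : y \in `[a, b]) (x_I : I x) (y_I : I y)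
    (x_lt_y : x < y) (lambda01 : 0 <= lambda <= 1) :
  (phi y - phi x)^-1 * oriented_integral (phi x) (phi y) f
    <= Num.max (f (phi x)) (f (phi y)).
Proof.
have phiI z : z \in `[a, b] -> I z -> I (phi z).
  by move=> zab zI; apply: phi_I; split.
apply: oriented_mean_le => t /[dup] t01 /andP[t0 t1]; apply/andP; split.
  apply: f_ge0; rewrite -in_setE.
  exact: (I_convex (phi x) (phi y) (Itv01 t0 t1)
           (mem_set (phiI x x_ab x_I)) (mem_set (phiI y y_ab y_I))).
by apply: f_qc.
Qed.
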